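(* There exists a proper translation-invariant distance $d$ on $\mathbb{R}$, inducing the standard topology of $\mathbb{R}$, such that $(\mathbb{R},d)$ is not linearly connected and has Nagata dimension $>1$.
   Context: A distance $d$ on $\mathbb{R}$ is translation-invariant if $d(x,y)=d(x+v,y+v)$ for all $x,y,v\in\mathbb{R}$. A distance is proper if all its closed balls are compact. A metric space $X$ is linearly connected if there is $\lambda\ge 1$ such that for all $x,y\in X$ there is a connected subset $S\subset X$ containing $x$ and $y$ with $\operatorname{diam}(S)\le \lambda d(x,y)$. Nagata dimension: for a cover $\mathcal{B}$ of a metric space $X$ and $s>0$, the $s$-multiplicity of $\mathcal{B}$ is the infimum of all $n$ such that every subset of $X$ of diameter $\le s$ meets at most $n$ members of $\mathcal{B}$. The cover $\mathcal{B}$ is $D$-bounded if $\operatorname{diam} B\le D$ for all $B\in\mathcal{B}$. The Nagata dimension $\dim_N X$ is the infimum (possibly $+\infty$) of all integers $n\geq 0$ for which there exists a constant $c>0$ such that, for all $s>0$, $X$ admits a $cs$-bounded cover with $s$-multiplicity at most $n+1$. *)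

(* Defs.v *)
From HB Require Import structures.
From mathcomp Require Import all_boot all_order all_algebra.
From mathcomp Require Import boolp classical_sets functions cardinality reals.
From mathcomp Require Import ereal topology normedtype.

Set Implicit Arguments.
Unset Strict Implicit.
Unset Printing Implicit Defensive.

Import Order.TTheory GRing.Theory Num.Theory.
Import numFieldNormedType.Exports.

Local Open Scope classical_set_scope.
Local Open Scope card_scope.
Local Open Scope ring_scope.

(* Nonnegativity is not a field: it follows from the four axioms. *)
Record distance (R : realType) (T : Type) := Distance {
  dist_fun :> T -> T -> R;
  dist_xx : forall x, dist_fun x x = 0;
  dist_eq0 : forall x y, dist_fun x y = 0 -> x = y;
  dist_sym : forall x y, dist_fun x y = dist_fun y x;
  dist_triangle : forall y x z, dist_fun x z <= dist_fun x y + dist_fun y z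
}.

(* A copy of T carrying the metric d and the topology it induces, in place of
   whatever topology T may already have. *)
Definition metrized (R : realType) (T : choiceType) (d : distance R T) : Type :=
  T.

Section metrized.
Context (R : realType) (T : choiceType) (d : distance R T).

HB.instance Definition _ := Choice.copy (metrized d) T.
HB.instance Definition _ := @isMetric.Build R (metrized d) d
  (dist_xx d) (dist_eq0 (d := d)) (dist_sym d) (dist_triangle d).

End metrized.

Definition translation_invariant (R : realType) (d : distance R R) :=
  forall x y v : R, d x y = d (x + v) (y + v).

Definition induces_standard_topology (R : realType) (d : distance R R) :=
  forall U : set R, @open (metrized d) U <-> @open R U.

Section metric_notions.
Context (R : realType) (X : metricType R).
Implicit Types (A B S : set X) (F : set (set X)).

(* Not the library's closed_ball, which is the closure of the open ball. *)
Definition proper_metric :=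
  forall (x : X) (r : R), compact [set y : X | mdist x y <= r].

(* Adding 0 gives the empty set diameter 0 instead of -oo. *)
Definition diam A : \bar R :=
  ereal_sup ([set 0%E] `|` [set (mdist p.1 p.2)%:E | p in A `*` A]).

Definition linearly_connected :=
  exists2 lambda : R, 1 <= lambda &
    forall x y : X, exists S : set X,
      [/\ connected S, S x, S y & (diam S <= (lambda * mdist x y)%:E)%E].

Definition is_cover F := \bigcup_(B in F) B = setT.

Definition bounded_by (D : R) F := forall B, F B -> (diam B <= D%:E)%E.

Definition multiplicity (s : R) F : \bar R :=
  ereal_inf [set (n%:R)%:E | n in [set n : nat |
    forall A, (diam A <= s%:E)%E ->
      [set B | F B /\ A `&` B !=set0] #<= `I_n]].

Definition nagata_dim : \bar R :=
  ereal_inf [set (n%:R)%:E | n in [set n : nat |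
    exists2 c : R, 0 < c & forall s : R, 0 < s ->
      exists F, [/\ is_cover F, bounded_by (c * s) F
        & (multiplicity s F <= (n.+1%:R)%:E)%E]]].

End metric_notions.

Arguments proper_metric {R} X.
Arguments linearly_connected {R} X.
Arguments nagata_dim {R} X.

(* Main.v *)
Require Import Defs.
From mathcomp Require Import all_boot all_order all_algebra.
From mathcomp Require Import boolp classical_sets functions cardinality.
From mathcomp Require Import reals ereal topology normedtype.
From mathcomp Require Import zify ring lra.

(** The distance is d(x, y) = rho (x - y), where
      rho x = sup_k c_k * dist (x, a_k Z),
      c_k = 2 ^ - (k ^ 2),   a_k = 2 ^ (k ^ 2 + 3 * k + 1).
    Each term is the pull-back of the arc length on a circle of length
    c_k * a_k, so rho is automatically even and subadditive: the upper bounds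
    on d come from subadditivity, the lower bounds from a single well chosen k.
    The parameters satisfy three constraints: a_j divides a_k for j <= k, the
    slopes c_k decrease, and c_{k+1} * a_k = 2 ^ k tends to infinity slowly
    compared with the ratios a_{k+1} / a_k.  By the first two, only the terms
    of index > k see a_k, and rho a_k = c_{k+1} * a_k = 2 ^ k.

    - Since rho x = |x| for |x| <= 1 and rho is bounded below elsewhere, the
      topology is the standard one ([drho_open]).  A real x between a_k / 2 and
      a_{k+1} / 2 satisfies rho x >= c_{k+1} * a_k / 2 = 2 ^ k / 2
      ([rho_far]), so d is proper.
    - A connected set containing 0 and a_k contains the interval between them,
      hence a_k / 2, which lies at distance c_k * a_k / 2 = 8 ^ k from 0, while
      d(0, a_k) is only 2 ^ k.  So no constant works for linear connectedness.
    - The points m * a_k + n * a_{k+1} with 0 <= m, n <= 2 ^ k look like a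
      square grid of mesh about 2 ^ k: the term k+1 detects m and the
      term k+2 detects n ([grid_left_right], [grid_bottom_top]).  A cover with
      s-multiplicity at most 2 and pieces too small to join opposite sides of
      such a grid would give a 3-colouring of the grid, by the side that a
      piece meets, in which no small triangle has three colours; this
      contradicts a form of Sperner's lemma ([sperner_square]).  As the side
      of the grid, measured in meshes, is unbounded, no constant c can
      witness Nagata dimension at most 1. *)

Set Implicit Arguments.
Unset Strict Implicit.
Unset Printing Implicit Defensive.

Import Order.TTheory GRing.Theory Num.Theory.
Import numFieldNormedType.Exports.

Local Open Scope ring_scope.

(** * A Sperner lemma on the square grid *)

Section Sperner.
Local Open Scope nat_scope.

Definition edge01 (u v : nat) := (u == 0) && (v == 1) || (u == 1) && (v == 0).

(** A triangle without all three colours either has no 01-edge or has only the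
    colours 0 and 1; a closed path between two colours changes colour an even
    number of times. *)
Lemma edge01_cocycle u v w : u < 3 -> v < 3 -> w < 3 ->
  ~~ uniq [:: u; v; w] -> edge01 u v (+) edge01 v w = edge01 u w.
Proof. by case: u v w => [|[|[|u]]] [|[|[|v]]] [|[|[|w]]]. Qed.

(** Each unit square is cut by its antidiagonal.  If no triangle is
    trichromatic, the parity of the number of 01-edges in a row is the same
    for all rows: the strip between two rows is a ladder of triangles with an
    even number of 01-edges each, and the vertical sides carry none.  But the
    bottom row goes from colour 0 to colour 1 through these two colours only,
    so its parity is odd, whereas the top row avoids colour 1. *)
Lemma sperner_square (L : nat) (col : nat -> nat -> nat) :
    (forall m n, col m n < 3) ->
    (forall n, n <= L -> col 0 n = 0) ->
    (forall n, n <= L -> col L n != 0) ->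
    (forall m, m <= L -> col m 0 != 2) ->
    (forall m, m <= L -> col m L != 1) ->
  exists m n, [/\ m < L, n < L &
    uniq [:: col m n; col m.+1 n; col m n.+1] \/
    uniq [:: col m.+1 n; col m n.+1; col m.+1 n.+1]].
Proof.
move=> col3 left0 right0 bottom2 top1; apply: contrapT => noT.
have lower m n : m < L -> n < L -> ~~ uniq [:: col m n; col m.+1 n; col m n.+1].
  by move=> mL nL; apply/negP => t; apply: noT; exists m, n; split=> //; left.
have upper m n :
    m < L -> n < L -> ~~ uniq [:: col m.+1 n; col m n.+1; col m.+1 n.+1].
  by move=> mL nL; apply/negP => t; apply: noT; exists m, n; split=> //; right.
pose par n m := \big[addb/false]_(i < m) edge01 (col i n) (col i.+1 n).
have parS n m : par n m.+1 = par n m (+) edge01 (col m n) (col m.+1 n).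
  by rewrite /par big_ord_recr.
have ladder n m : n < L -> m <= L ->
    par n m (+) edge01 (col m n) (col m n.+1) =
    edge01 (col 0 n) (col 0 n.+1) (+) par n.+1 m.
  move=> nL; elim: m => [|m IH] mL.
    by rewrite /par !big_ord0 addbF.
  have {}IH := IH (ltnW mL).
  rewrite !parS addbA -IH -!addbA; congr (_ (+) _).
  have e1 := edge01_cocycle (col3 m n) (col3 m.+1 n) (col3 m n.+1)
    (lower _ _ mL nL).
  have e2 := edge01_cocycle (col3 m.+1 n) (col3 m n.+1) (col3 m.+1 n.+1)
    (upper _ _ mL nL).
  by rewrite -e1 -e2 addbA.
have par_const n : n <= L -> par n L = par 0 L.
  elim: n => // n IH nL; rewrite -IH; last exact: ltnW.
  have := ladder n L nL (leqnn L).
  rewrite /edge01 !left0 ?(ltnW nL) //= (negPf (right0 n (ltnW nL))).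
  by rewrite (negPf (right0 _ nL)) andbF addbF.
have par_top : par L L = false.
  rewrite /par big1 // => -[i iL] _; rewrite /edge01 /=.
  by rewrite (negPf (top1 i _)) ?(negPf (top1 i.+1 _)) ?andbF // ltnW.
have par_bottom m : m <= L -> par 0 m = (col m 0 == 1).
  elim: m => [|m IH] mL; first by rewrite /par big_ord0 left0.
  rewrite parS IH; last exact: ltnW.
  move: (col3 m 0) (col3 m.+1 0) (bottom2 _ (ltnW mL)) (bottom2 _ mL).
  by case: (col m 0) (col m.+1 0) => [|[|[|?]]] [|[|[|?]]].
have := par_const L (leqnn L); rewrite par_top par_bottom //.
move: (right0 0 (leq0n L)) (bottom2 L (leqnn L)) (col3 L 0).
by case: (col L 0) => [|[|[|?]]].
Qed.

End Sperner.

(** * Covers of a metric space that contains large grids *)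

Section covers.
Context (R : realType) (X : metricType R).
Local Open Scope classical_set_scope.
Local Open Scope card_scope.

Lemma diam_ge (A : set X) x y : A x -> A y -> ((mdist x y)%:E <= diam A)%E.
Proof.
by move=> Ax Ay; apply: ereal_sup_ubound; right; exists (x, y).
Qed.

Lemma diam_le (A : set X) (s : R) : 0 <= s ->
  (forall x y, A x -> A y -> mdist x y <= s) -> (diam A <= s%:E)%E.
Proof.
move=> s0 As; apply: ge_ereal_sup => _ [->|[[x y] [/= Ax Ay] <-]].
  by rewrite lee_fin.
by rewrite lee_fin; exact: As.
Qed.

(** The test set of diameter at most s is {x, y, z}. *)
Lemma multiplicity_gt2 (s : R) (F : set (set X)) (B1 B2 B3 : set X) (x y z : X) :
    F B1 -> F B2 -> F B3 -> B1 x -> B2 y -> B3 z ->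
    B1 <> B2 -> B1 <> B3 -> B2 <> B3 ->
    mdist x y <= s -> mdist x z <= s -> mdist y z <= s ->
  (2%:E < multiplicity s F)%E.
Proof.
move=> F1 F2 F3 B1x B2y B3z d12 d13 d23 xy xz yz.
have s0 : 0 <= s := le_trans (mdist_ge0 _ _) xy.
apply: (@lt_le_trans _ _ 3%:E); first by rewrite lte_fin ltr_nat.
apply: le_ereal_inf_tmp => _ [n /= mul_n <-]; rewrite lee_fin ler_nat.
have /card_leP[f] : [set B1; B2; B3] #<= `I_n.
  apply: (@card_le_trans _ _ _ [set B | F B /\ [set x; y; z] `&` B !=set0]);
      last first.
    apply: mul_n; apply: diam_le => // u v.
    by move=> [[->|->]|->] [[->|->]|->] //; rewrite ?mdistxx // metric_sym.
  apply: subset_card_le => _ [[->|->]|->]; split=> //.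
  - by exists x; split=> //; left; left.
  - by exists y; split=> //; left; right.
  - by exists z; split=> //; right.
have i1 : B1 \in [set B1; B2; B3] by rewrite inE; left; left.
have i2 : B2 \in [set B1; B2; B3] by rewrite inE; left; right.
have i3 : B3 \in [set B1; B2; B3] by rewrite inE; right.
have inj C D : val (f C) = val (f D) -> val C = val D.
  by move=> /val_inj /('inj_f (mem_set I) (mem_set I)) ->.
have lt C : (val (f C) < n)%N := set_mem (valP (f C)).
pose v C (iC : C \in [set B1; B2; B3]) := val (f (SigSub iC : [set B1; B2; B3])).
have sub : {subset [:: v _ i1; v _ i2; v _ i3] <= iota 0 n}.
  by move=> i; rewrite !inE mem_iota /= add0n => /or3P[]/eqP->; exact: lt.
have := uniq_leq_size _ sub; rewrite size_iota; apply.
rewrite /= !inE negb_or !andbT -andbA; apply/and3P; split.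
all: by apply/eqP => /inj.
Qed.

(** A piece of diameter at most D cannot meet two opposite sides of the grid.
    Choose a piece through each grid point and colour the point by the side
    that this piece meets (0 for the left side, otherwise 1 for the bottom
    side, otherwise 2).  The boundary conditions of Sperner's lemma hold, and
    the vertices of a trichromatic triangle lie in three different pieces. *)
Lemma grid_multiplicity (L : nat) (P : nat -> nat -> X) (D s : R)
    (F : set (set X)) :
    is_cover F -> bounded_by D F ->
    (forall m n (i j i' j' : bool),
       mdist (P (i + m) (j + n))%N (P (i' + m) (j' + n))%N <= s) ->
    (forall n n', (n <= L)%N -> (n' <= L)%N -> D < mdist (P 0%N n) (P L n')) ->
    (forall m m', (m <= L)%N -> (m' <= L)%N -> D < mdist (P m 0%N) (P m' L)) ->
  (2%:E < multiplicity s F)%E.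
Proof.
move=> covF bndF adj lr bt.
have small B x y : F B -> B x -> B y -> mdist x y <= D.
  by move=> FB Bx By; rewrite -lee_fin (le_trans (diam_ge Bx By)) // bndF.
have [B BP] : {B : nat -> nat -> set X & forall m n, F (B m n) /\ B m n (P m n)}.
  have piece p : {C : set X | F C /\ C p}.
    apply: cid; have : [set: X] p by [].
    by rewrite -covF => -[C FC Cp]; exists C.
  exists (fun m n => projT1 (piece (P m n))) => m n.
  exact: (projT2 (piece (P m n))).
have FB m n : F (B m n) by case: (BP m n).
have {}BP m n : B m n (P m n) by case: (BP m n).
pose left (C : set X) := `[<exists2 n, (n <= L)%N & C (P 0%N n)>].
pose bottom (C : set X) := `[<exists2 m, (m <= L)%N & C (P m 0%N)>].
pose colour C := if left C then 0%N else if bottom C then 1%N else 2%N.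
have colour_neq C C' : colour C != colour C' -> C <> C'.
  by move=> + e; rewrite e eqxx.
have [|n nL|n nL|m mL|m mL|m [n [mL nL tri]]] :=
  @sperner_square L (fun m n => colour (B m n)).
- by move=> m n; rewrite /colour; case: ifP => // _; case: ifP.
- rewrite /colour; case: ifPn => // /asboolPn[].
  by exists n.
- rewrite /colour; case: ifPn => [/asboolP[n' n'L Bn']|_]; last by case: ifP.
  have := small _ _ _ (FB L n) Bn' (BP L n).
  by rewrite leNgt lr.
- rewrite /colour; case: ifPn => // _; case: ifPn => // /asboolPn[].
  by exists m.
- rewrite /colour; case: ifPn => // _; case: ifPn => // /asboolP[m' m'L Bm'].
  have := small _ _ _ (FB m L) Bm' (BP m L).
  by rewrite leNgt bt.
- case: tri; rewrite /= !inE negb_or !andbT => /andP[/andP[]].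
  + move=> /colour_neq d12 /colour_neq d13 /colour_neq d23.
    apply: (multiplicity_gt2 _ _ _ (BP m n) (BP m.+1 n) (BP m n.+1)) => //.
    * exact: (adj m n false false true false).
    * exact: (adj m n false false false true).
    * exact: (adj m n true false false true).
  + move=> /colour_neq d12 /colour_neq d13 /colour_neq d23.
    apply: (multiplicity_gt2 _ _ _ (BP m.+1 n) (BP m n.+1) (BP m.+1 n.+1)) => //.
    * exact: (adj m n true false false true).
    * exact: (adj m n true false true true).
    * exact: (adj m n false true true true).
Qed.

Lemma nagata_dim_gt1 :
    (forall c : R, 0 < c -> exists2 s : R, 0 < s & forall F : set (set X),
      is_cover F -> bounded_by (c * s) F -> (2%:E < multiplicity s F)%E) ->
  (1 < nagata_dim X)%E.
Proof.
move=> H; apply: (@lt_le_trans _ _ 2%:E); first by rewrite lte_fin ltr1n.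
apply: le_ereal_inf_tmp => _ [n /= [c c0 Hc] <-]; rewrite lee_fin ler_nat.
rewrite leqNgt; apply/negP => n2.
have [s s0 Hs] := H c c0; have [F [covF bndF]] := Hc s s0.
rewrite leNgt => /negP; apply; apply: le_lt_trans (Hs F covF bndF).
by rewrite lee_fin ler_nat.
Qed.

End covers.

(** * Distance to the multiples of a real number *)

Section lattice.
Context (R : realType).
Implicit Types (a x y : R) (n : int).

Definition lattice_dist a x : R :=
  `|x - a * (Num.floor (x / a + 2^-1))%:~R|.

(** The floor in the definition picks the nearest multiple: this minimality is
    what makes the function subadditive, even and periodic. *)
Lemma lattice_dist_le a x n : 0 < a -> lattice_dist a x <= `|x - a * n%:~R|.
Proof.
move=> a0; have [y ->] : exists y, x = a * y.
  by exists (x / a); rewrite mulrC divfK // gt_eqF.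
rewrite /lattice_dist (mulrAC a) divff ?gt_eqF // mul1r.
rewrite -!mulrBr !normrM ler_pM2l ?normr_gt0 ?gt_eqF //.
set m := Num.floor _; have /andP[] := floor_itv (y + 2^-1).
rewrite -/m intrD => m1 m2.
have ym : `|y - m%:~R| <= 2^-1 by rewrite ler_norml; apply/andP; split; lra.
have [->//|nm] := eqVneq n m.
apply: le_trans ym _; rewrite ler_normr.
have [nm1|nm1] := leP (m + 1) n.
  apply/orP; right; have := nm1; rewrite -(ler_int R) intrD => ?; lra.
apply/orP; left; have : n + 1 <= m by rewrite lezD1 lt_neqAle nm -ltzD1.
rewrite -(ler_int R) intrD => ?; lra.
Qed.

Lemma lattice_dist_le_norm a x : 0 < a -> lattice_dist a x <= `|x|.
Proof. by move=> /(lattice_dist_le x 0); rewrite mulr0 subr0. Qed.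

Lemma lattice_dist_norm a x : 0 < a -> `|x| <= a / 2 -> lattice_dist a x = `|x|.
Proof.
move=> a0 xa; apply/eqP; rewrite eq_le lattice_dist_le_norm //=.
rewrite /lattice_dist; set m := Num.floor _.
have [->|m0] := eqVneq m 0; first by rewrite mulr0 subr0.
have am : a <= `|a * m%:~R|.
  rewrite normrM (gtr0_norm a0) ler_peMr ?(ltW a0) // -intr_norm.
  by rewrite ler1z -gtz0_ge1 normr_gt0.
have := lerB_dist (a * m%:~R) x; rewrite (distrC _ x) => ?; lra.
Qed.

Lemma lattice_distD a x y : 0 < a ->
  lattice_dist a (x + y) <= lattice_dist a x + lattice_dist a y.
Proof.
move=> a0; apply: le_trans (ler_normD _ _).
set m := Num.floor (x / a + _); set n := Num.floor (y / a + _).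
apply: le_trans (lattice_dist_le _ (m + n) a0) _.
by rewrite intrD mulrDr opprD addrACA.
Qed.

Lemma lattice_distN a x : 0 < a -> lattice_dist a (- x) = lattice_dist a x.
Proof.
move=> a0; have le z : lattice_dist a (- z) <= lattice_dist a z.
  rewrite {2}/lattice_dist; set m := Num.floor _.
  apply: le_trans (lattice_dist_le _ (- m) a0) _.
  by rewrite intrN mulrN -opprD normrN.
by apply/eqP; rewrite eq_le le /= -{1}(opprK x) le.
Qed.

Lemma lattice_dist_mul a n : 0 < a -> lattice_dist a (a * n%:~R) = 0.
Proof.
move=> a0; apply/eqP; rewrite eq_le normr_ge0 andbT.
by apply: le_trans (lattice_dist_le _ n a0) _; rewrite subrr normr0.
Qed.

Lemma lattice_dist_periodic a x n : 0 < a ->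
  lattice_dist a (x + a * n%:~R) = lattice_dist a x.
Proof.
move=> a0; apply/eqP; rewrite eq_le; apply/andP; split.
  by apply: le_trans (lattice_distD _ _ a0) _; rewrite lattice_dist_mul // addr0.
rewrite -{1}(addrK (a * n%:~R) x); apply: le_trans (lattice_distD _ _ a0) _.
by rewrite lattice_distN // lattice_dist_mul // addr0.
Qed.

End lattice.

(** * The group norm rho *)

Section rho.
Context (R : realType).
Implicit Types (x y : R) (k : nat).
Local Open Scope classical_set_scope.

Definition period k : R := 2 ^+ (k ^ 2 + 3 * k + 1).
Definition slope k : R := 2 ^- (k ^ 2).

Lemma period_gt0 k : 0 < period k. Proof. exact: exprn_gt0. Qed.
Lemma slope_gt0 k : 0 < slope k. Proof. by rewrite invr_gt0 exprn_gt0. Qed.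
Hint Resolve period_gt0 slope_gt0 : core.

Lemma period0 : period 0 = 2. Proof. by rewrite /period expr1. Qed.
Lemma slope0 : slope 0 = 1. Proof. by rewrite /slope expr0 invr1. Qed.

Lemma slope_anti j k : (j <= k)%N -> slope k <= slope j.
Proof.
move=> jk; rewrite lef_pV2 ?posrE ?exprn_gt0 //.
by rewrite ler_eXn2l ?ltr1n // leq_exp2r.
Qed.

Lemma period_le j k : (j <= k)%N -> period j <= period k.
Proof.
by move=> jk; rewrite ler_eXn2l ?ltr1n // leq_add2r leq_add ?leq_exp2r ?leq_mul.
Qed.

Lemma period_dvd j k : (j <= k)%N -> exists n : int, period k = period j * n%:~R.
Proof.
move=> jk; exists (2 ^+ ((k ^ 2 + 3 * k + 1) - (j ^ 2 + 3 * j + 1))).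
by rewrite rmorphXn /= -exprD subnKC // leq_add2r leq_add ?leq_exp2r ?leq_mul.
Qed.

Lemma periodS k : period k.+1 = 16 * period k * (2 ^+ k) ^+ 2.
Proof.
have -> : 16 = 2 ^+ 4 :> R by rewrite -natrX.
by rewrite -exprM -!exprD /period; congr (_ ^+ _); lia.
Qed.

(** This is the norm of [period k], and the mesh of the k-th grid. *)
Lemma slopeS_period k : slope k.+1 * period k = 2 ^+ k.
Proof.
have -> : period k = 2 ^+ (k.+1 ^ 2) * 2 ^+ k.
  by rewrite -exprD; congr (_ ^+ _); lia.
by rewrite mulKf // expf_neq0.
Qed.

Lemma slope_period k : slope k * period k = 2 * 2 ^+ (3 * k).
Proof.
have -> : period k = 2 ^+ (k ^ 2) * (2 * 2 ^+ (3 * k)).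
  by rewrite -exprS -exprD; congr (_ ^+ _); lia.
by rewrite mulKf // expf_neq0.
Qed.

Lemma pow2_unbounded x : exists k, x < 2 ^+ k.
Proof.
exists (Num.bound `|x|); apply: le_lt_trans (ler_norm x) _.
apply: lt_trans (archi_boundP (normr_ge0 x)) _.
by rewrite -natrX ltr_nat ltn_expl.
Qed.

Definition rho x := sup [set slope k * lattice_dist (period k) x | k in setT].

Lemma slope_lattice_le k x : slope k * lattice_dist (period k) x <= slope k * `|x|.
Proof. by rewrite ler_pM2l ?lattice_dist_le_norm. Qed.

Lemma rho_le x y :
  (forall k, slope k * lattice_dist (period k) x <= y) -> rho x <= y.
Proof.
move=> H; apply: ge_sup; last by move=> _ [k _ <-].
by exists (slope 0 * lattice_dist (period 0) x); exists 0%N.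
Qed.

Lemma rho_ge k x : slope k * lattice_dist (period k) x <= rho x.
Proof.
apply: ub_le_sup; last by exists k.
exists `|x| => _ [j _ <-]; apply: le_trans (slope_lattice_le _ _) _.
by rewrite ler_piMl // -slope0 slope_anti.
Qed.

Lemma rho_ge0 x : 0 <= rho x.
Proof. by apply: le_trans (rho_ge 0 x); rewrite mulr_ge0 ?normr_ge0 // ltW. Qed.

Lemma rho_le_norm x : rho x <= `|x|.
Proof.
apply: rho_le => k; apply: le_trans (slope_lattice_le _ _) _.
by rewrite ler_piMl // -slope0 slope_anti.
Qed.

Lemma rho0 : rho 0 = 0.
Proof.
by have := rho_le_norm 0; rewrite normr0 => r0; apply/le_anti; rewrite r0 rho_ge0.
Qed.

Lemma rhoD x y : rho (x + y) <= rho x + rho y.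
Proof.
apply: rho_le => k; apply: le_trans (lerD (rho_ge k x) (rho_ge k y)).
by rewrite -mulrDr ler_pM2l // lattice_distD.
Qed.

Lemma rhoN x : rho (- x) = rho x.
Proof.
by rewrite /rho; congr sup; apply/eq_imagel => k _; rewrite lattice_distN.
Qed.

Lemma rho_ge_slope k x : `|x| <= period k / 2 -> slope k * `|x| <= rho x.
Proof. by move=> xk; rewrite -(lattice_dist_norm (period_gt0 k) xk) rho_ge. Qed.

Lemma rho_norm x : `|x| <= 1 -> rho x = `|x|.
Proof.
move=> x1; apply/eqP; rewrite eq_le rho_le_norm -{1}[`|x|]mul1r -slope0.
by apply: rho_ge_slope; rewrite period0 divff.
Qed.

(** Take the least index j+1 whose circle is large enough not to wrap x around.
    Then the corresponding term is linear at x, and |x| > a_j / 2, so it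
    exceeds c_{j+1} * a_j / 2 = 2 ^ j / 2. *)
Lemma rho_far k x : period k / 2 < `|x| -> 2 ^+ k / 2 <= rho x.
Proof.
move=> kx.
have ex : exists j, `|x| <= period j / 2.
  have [j xj] := pow2_unbounded `|x|; exists j; apply: le_trans (ltW xj) _.
  have -> : period j = 2 ^+ (j ^ 2 + 3 * j) * 2 by rewrite /period addn1 exprSr.
  by rewrite mulfK // ler_eXn2l ?ltr1n //; lia.
have [j xj jmin] := ex_minnP ex.
have kj : (k < j)%N.
  rewrite ltnNge; apply/negP => /period_le jk.
  by have := lt_le_trans kx xj; rewrite ltr_pM2r ?invr_gt0 // ltNge jk.
case: j kj xj jmin => // j kj xj jmin.
apply: le_trans (rho_ge_slope xj).
have jx : period j / 2 < `|x|.
  by rewrite ltNge; apply/negP => /jmin; rewrite ltnn.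
apply: le_trans (ler_wpM2l (ltW (slope_gt0 j.+1)) (ltW jx)).
by rewrite mulrA slopeS_period ler_pM2r ?invr_gt0 // ler_eXn2l ?ltr1n.
Qed.

Lemma rho_eq0 x : rho x = 0 -> x = 0.
Proof.
move=> x0; have [x1|x1] := leP `|x| 1.
  by apply/normr0_eq0; rewrite -rho_norm.
have := @rho_far 0 x; rewrite period0 divff // expr0 x0 => /(_ x1); lra.
Qed.

Lemma rho_lt_half x : rho x < 2^-1 -> `|x| = rho x.
Proof.
move=> xh; rewrite rho_norm // leNgt; apply/negP => x1.
have := @rho_far 0 x; rewrite period0 divff // expr0 => /(_ x1); lra.
Qed.

(** The terms of index j <= k vanish at the multiples of a_k by divisibility;
    the slopes of the others are at most c_{k+1}. *)
Lemma rho_period k (n : int) : rho (period k * n%:~R) <= 2 ^+ k * `|n%:~R|.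
Proof.
apply: rho_le => j; have [jk|kj] := leqP j k.
  have [m ->] := period_dvd jk; rewrite -mulrA -intrM lattice_dist_mul // mulr0.
  by rewrite mulr_ge0 // exprn_ge0.
apply: le_trans (slope_lattice_le _ _) _.
rewrite normrM (gtr0_norm (period_gt0 k)) mulrA -slopeS_period.
by rewrite ler_wpM2r // ler_pM2r // slope_anti.
Qed.

End rho.

(** * The metric on the line *)

Section example.
Context (R : realType).
Implicit Types (x y : R) (k : nat).
Local Open Scope classical_set_scope.

Lemma rho_distxx x : rho (x - x) = 0.
Proof. by rewrite subrr rho0. Qed.

Lemma rho_dist_eq0 x y : rho (x - y) = 0 -> x = y.
Proof. by move=> /rho_eq0/eqP; rewrite subr_eq0 => /eqP. Qed.

Lemma rho_dist_sym x y : rho (x - y) = rho (y - x).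
Proof. by rewrite -rhoN opprB. Qed.

Lemma rho_dist_triangle y x z : rho (x - z) <= rho (x - y) + rho (y - z).
Proof. by apply: le_trans (rhoD _ _); rewrite addrA subrK. Qed.

Definition drho : distance R R :=
  Distance rho_distxx rho_dist_eq0 rho_dist_sym rho_dist_triangle.

Let X : metricType R := metrized drho.

Lemma drhoE (x y : X) : mdist x y = rho ((x : R) - (y : R)).
Proof. by []. Qed.

(** d is at most the usual distance, and agrees with it below 1 / 2. *)
Lemma drho_open (U : set R) : @open X U <-> @open R U.
Proof.
have small_ball x (e : R) : 0 < e ->
    ball (x : X) (Num.min e 2^-1) `<=` ball (x : R) e.
  move=> e0 y; rewrite ballEmdist /= drhoE lt_min => /andP[ye yh].
  by rewrite -ball_normE /= (rho_lt_half yh).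
have sub_ball x (e : R) : ball (x : R) e `<=` ball (x : X) e.
  move=> y; rewrite -ball_normE ballEmdist /= drhoE.
  exact: le_lt_trans (rho_le_norm _).
rewrite !openE; split=> Uo x /Uo /nbhs_ballP[e /= e0 eU]; apply/nbhs_ballP.
- by exists e => //= y /sub_ball /eU.
- exists (Num.min e 2^-1) => /=; first by rewrite lt_min e0 invr_gt0 ltr0n.
  by move=> y /small_ball /eU; exact.
Qed.

Lemma id_continuous_to : continuous (id : R -> X).
Proof. by apply/continuousP => A /drho_open. Qed.

Lemma id_continuous_from : continuous (id : X -> R).
Proof. by apply/continuousP => A /drho_open. Qed.

(** The closed d-ball is closed in the usual topology, and bounded because rho
    tends to infinity. *)
Lemma drho_proper : proper_metric X.
Proof.
move=> x r; pose K : set R := [set y | rho (x - y) <= r].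
have -> : [set y : X | mdist x y <= r] = (id : R -> X) @` K.
  by rewrite image_id.
apply: continuous_compact.
  by apply: continuous_subspaceT; exact: id_continuous_to.
have [k rk] := pow2_unbounded (2 * r).
apply: (@subclosed_compact _ K `[x - period R k / 2, x + period R k / 2]).
- rewrite -openC; apply/drho_open; rewrite openE => y /= /negP.
  rewrite -ltNge => ry.
  apply/nbhs_ballP; exists (rho (x - y) - r); first by rewrite /= subr_gt0.
  move=> z; rewrite ballEmdist /= drhoE /= => yz; apply/negP; rewrite -ltNge.
  have := rho_dist_triangle z x y; rewrite (rho_dist_sym z y); lra.
- exact: segment_compact.
- move=> y /= xy; rewrite in_itv /=.
  have : `|x - y| <= period R k / 2.
    rewrite leNgt; apply/negP => /rho_far; rewrite /K /= in xy; lra.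
  rewrite ler_norml => /andP[? ?]; apply/andP; split; lra.
Qed.

(** The points 0 and a_k are at distance at most 2 ^ k, but a_k / 2 separates
    them and is at distance at least 8 ^ k from 0. *)
Lemma drho_not_linearly_connected : ~ linearly_connected X.
Proof.
move=> [lam lam1 conn]; have [k lamk] := pow2_unbounded lam.
have a0 := period_gt0 R k.
have [S [connS S0 Sa diamS]] := conn (0 : R) (period R k).
have connR : @connected R S.
  rewrite -[S]image_id; apply: (@connected_continuous_connected X R S id) => //.
  by apply: continuous_subspaceT; exact: id_continuous_from.
have Sh : S (period R k / 2).
  move/connected_intervalP : connR; apply; [exact: S0|exact: Sa|].
  apply/andP; split; lra.
have := le_trans (diam_ge Sh S0) diamS; rewrite !drhoE lee_fin.
rewrite subr0 sub0r rhoN; apply/negP; rewrite -ltNge.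
have upper : rho (period R k) <= 2 ^+ k.
  by have := rho_period R k 1; rewrite !mulr1 normr1 mulr1.
have lower : 2 ^+ (3 * k) <= rho (period R k / 2).
  have h : `|period R k / 2| = period R k / 2 by rewrite gtr0_norm // divr_gt0.
  have := @rho_ge_slope _ k (period R k / 2).
  by rewrite h mulrA slope_period (mulrC 2) mulfK // => /(_ (lexx _)).
have T1 : 1 <= 2 ^+ k :> R by rewrite exprn_ege1 // ler1n.
have T3 : 2 ^+ (3 * k) = 2 ^+ k * 2 ^+ k * 2 ^+ k :> R.
  by rewrite -!exprD; congr (_ ^+ _); lia.
rewrite T3 in lower; move: T1 upper lower lamk lam1.
set T := 2 ^+ k; set u := rho _; set v := rho _ => *.
apply: lt_le_trans (_ : T * T <= _); nra.
Qed.

(** * Large grids in the line *)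

Definition grid k (m n : nat) : R := period R k * m%:R + period R k.+1 * n%:R.

Lemma grid_sub k m n m' n' : grid k m n - grid k m' n' =
  period R k * (m%:Z - m'%:Z)%:~R + period R k.+1 * (n%:Z - n'%:Z)%:~R.
Proof. by rewrite /grid !rmorphB /= !pmulrn; ring. Qed.

Lemma grid_adjacent k m n (i j i' j' : bool) :
  rho (grid k (i + m) (j + n) - grid k (i' + m) (j' + n)) <= 2 ^+ k.+2.
Proof.
have unit (b b' : bool) p : `|((b + p)%:Z - (b' + p)%:Z)%:~R| <= 1 :> R.
  rewrite !PoszD opprD addrACA subrr addr0.
  by case: b b' => [] [] /=; rewrite ?normr1 ?normr0 ?normrN1.
rewrite grid_sub; apply: le_trans (rhoD _ _) _.
have := lerD (rho_period R k ((i + m)%:Z - (i' + m)%:Z))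
             (rho_period R k.+1 ((j + n)%:Z - (j' + n)%:Z)).
move/le_trans; apply; rewrite !(exprS _ k.+1) !(exprS _ k).
have T1 : 1 <= 2 ^+ k :> R by rewrite exprn_ege1 // ler1n.
have := unit i i' m; have := unit j j' n.
set T := 2 ^+ k in T1 *; set a := `|_|; set b := `|_| => *; nra.
Qed.

(** The term k+1 of rho ignores multiples of a_{k+1}, so it only sees
    2 ^ k * a_k, where it is linear. *)
Lemma grid_left_right k n n' :
  2 ^+ k * 2 ^+ k <= rho (grid k 0 n - grid k (2 ^ k) n').
Proof.
apply: le_trans (rho_ge k.+1 _).
rewrite grid_sub lattice_dist_periodic ?period_gt0 //.
rewrite sub0r rmorphN /= mulrN lattice_distN ?period_gt0 //.
have -> : (2 ^ k)%N%:~R = 2 ^+ k :> R by rewrite -pmulrn natrX.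
have a0 := period_gt0 R k.
have T1 : 1 <= 2 ^+ k :> R by rewrite exprn_ege1 // ler1n.
have absE : `|period R k * 2 ^+ k| = period R k * 2 ^+ k.
  by rewrite ger0_norm // mulr_ge0 ?exprn_ge0 // ltW.
rewrite lattice_dist_norm ?period_gt0 // absE ?mulrA ?slopeS_period //.
rewrite periodS; set T := 2 ^+ k in T1 *; set a := period R k in a0 *.
have : 0 < a * T by rewrite mulr_gt0 //; lra.
nra.
Qed.

(** The term k+2 of rho is linear up to a_{k+2} / 2, hence on the whole grid;
    there the contribution of the multiples of a_k is negligible, because
    16 * a_k <= a_{k+1}, and at most halves the contribution of
    2 ^ k * a_{k+1}. *)
Lemma grid_bottom_top k m m' : (m <= 2 ^ k)%N -> (m' <= 2 ^ k)%N ->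
  2 ^+ k * 2 ^+ k <= rho (grid k m 0 - grid k m' (2 ^ k)).
Proof.
move=> mk m'k; rewrite grid_sub sub0r rmorphN /= mulrN.
have -> : (2 ^ k)%N%:~R = 2 ^+ k :> R by rewrite -pmulrn natrX.
have uT : `|(m%:Z - m'%:Z)%:~R| <= 2 ^+ k :> R.
  have le2 p : (p <= 2 ^ k)%N -> p%:R <= 2 ^+ k :> R.
    by move=> pk; rewrite -natrX ler_nat.
  rewrite rmorphB /= -!pmulrn ler_norml.
  by have := le2 _ mk; have := le2 _ m'k; have := ler0n R m;
    have := ler0n R m' => *; apply/andP; split; lra.
set u : R := _%:~R in uT *; rewrite -rhoN opprD opprK.
have a0 := period_gt0 R k.
have T1 : 1 <= 2 ^+ k :> R by rewrite exprn_ege1 // ler1n.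
have c0 := slope_gt0 R k.+2.
have w := slopeS_period R k.+1; rewrite exprS in w.
have a1 := periodS R k.
have a2 := periodS R k.+1; rewrite exprS in a2.
have au : `|- (period R k * u)| <= period R k * 2 ^+ k.
  by rewrite normrN normrM gtr0_norm // ler_pM2l.
have b0 := period_gt0 R k.+1.
have aT : 16 * (period R k * 2 ^+ k) <= period R k.+1 * 2 ^+ k.
  by rewrite a1; set T := 2 ^+ k in T1 *; rewrite -!mulrA !ler_pM2l //; nra.
move: au; set z := - _; rewrite ler_norml => /andP[z1 z2].
set x := z + _.
have xlow : period R k.+1 * 2 ^+ k / 2 <= `|x|.
  by apply: le_trans (ler_norm _); rewrite /x; nra.
have xhigh : `|x| <= period R k.+2 / 2.
  have bT : 4 * (period R k.+1 * 2 ^+ k) <= period R k.+2.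
    rewrite a2 exprS; set T := 2 ^+ k in T1 *; set b := period R k.+1 in b0 *.
    have : 0 < b * T by rewrite mulr_gt0 //; lra.
    nra.
  have aT0 : 0 < period R k * 2 ^+ k by rewrite mulr_gt0 ?exprn_gt0.
  rewrite ler_norml; apply/andP; split; rewrite /x; lra.
apply: le_trans (rho_ge_slope xhigh).
apply: le_trans (ler_wpM2l (ltW c0) xlow); rewrite !mulrA w.
set T := 2 ^+ k in T1 *; nra.
Qed.

(** The scale s is 4 meshes and the side of the grid is at least 2 ^ k
    meshes, so k has to be chosen with 2 ^ k > 4 * c. *)
Lemma drho_nagata_dim : (1 < nagata_dim X)%E.
Proof.
apply: nagata_dim_gt1 => c c0; have [k ck] := pow2_unbounded (4 * c).
have T0 : 0 < 2 ^+ k :> R by rewrite exprn_gt0.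
have big : c * 2 ^+ k.+2 < 2 ^+ k * 2 ^+ k.
  by rewrite !exprS; move: T0 ck; set T := 2 ^+ k => *; nra.
exists (2 ^+ k.+2) => [|F covF bndF]; first exact: exprn_gt0.
apply: (@grid_multiplicity R X (2 ^ k) (grid k) _ _ F covF bndF).
- by move=> m n i j i' j'; rewrite drhoE grid_adjacent.
- by move=> n n' _ _; rewrite drhoE; apply: lt_le_trans (grid_left_right _ _ _).
- move=> m m' mk m'k; rewrite drhoE.
  exact: lt_le_trans (grid_bottom_top mk m'k).
Qed.

End example.

Theorem theorem1p10 (R : realType) :
  exists d : distance R R,
    [/\ translation_invariant d,
        induces_standard_topology d,
        proper_metric (metrized d),
        ~ linearly_connected (metrized d)
      & (1 < nagata_dim (metrized d))%E].
Proof.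
exists (drho R); split.
- by move=> x y v /=; rewrite opprD addrACA subrr addr0.
- exact: drho_open.
- exact: drho_proper.
- exact: drho_not_linearly_connected.
- exact: drho_nagata_dim.
Qed.
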